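(* Let $\phi:\mathbb{R}\to\mathbb{R}$ be the generalized Airy function of order 4, $$\phi(x)=\frac{1}{2\pi}\int_{-\infty}^{\infty}\exp\left\{ixy-\frac{y^4}{4}\right\}dy,$$ which satisfies $\phi^{(3)}(x)=x\phi(x)$, and let $$v(t,x)=\frac{1}{2\pi}\int_{-\infty}^{\infty}\exp\left\{i\lambda x-\frac{1}{2}\lambda^2t-\frac{\lambda^4}{4}\right\}d\lambda,\qquad t\geq 0,\ x\in\mathbb{R}.$$ Let $\xi\in\mathbb{R}$ be such that $\phi(\xi)=0$, and let $f:[0,\infty)\to\mathbb{R}$ be a solution of the Rayleigh-type ordinary differential equation $$f''(t)=2\left[f'(t)\right]^3-\frac{1}{2}tf'(t)-\frac{1}{4}f(t),\qquad t\ge 0,$$ with initial conditions $$f(0)=\xi,\qquad f'(0)=-\frac{\phi^{(2)}(\xi)}{2\phi^{(1)}(\xi)}.$$ Then, for every $t\geq 0$, $$v(t,f(t))=0.$$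
   Context: $\phi^{(n)}$ denotes the $n$-th derivative of $\phi$. The function $v$ is the form of the Pearcey integral studied here; it solves the heat equation $v_t=\frac12 v_{xx}$, and $v(0,\cdot)=\phi$. *)

(* Defs.v *)
From mathcomp Require Import all_boot all_order all_algebra complex.
From mathcomp Require Import all_classical all_reals all_analysis measurable_realfun.

Set Implicit Arguments.
Unset Strict Implicit.
Unset Printing Implicit Defensive.

Import Order.TTheory GRing.Theory Num.Theory.
Import numFieldNormedType.Exports.

Local Open Scope classical_set_scope.
Local Open Scope ring_scope.
Local Open Scope complex_scope.

(* MathComp-Analysis has no exponential on R[i]; this is
   e^(a + ib) = e^a (cos b + i sin b). *)
Definition cexp (R : realType) (z : R[i]) : R[i] :=
  (expR (complex.Re z))%:C * (cos (complex.Im z) +i* sin (complex.Im z)).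

Definition cintegral (R : realType) (g : R -> R[i]) : R[i] :=
  (\int[@lebesgue_measure R]_y complex.Re (g y)) +i*
  (\int[@lebesgue_measure R]_y complex.Im (g y)).

Definition airy4C (R : realType) (x : R) : R[i] :=
  ((2 * pi)^-1)%:C *
  cintegral (fun y : R => cexp ('i * x%:C * y%:C - y%:C ^+ 4 / 4)).

(* Taking the real part loses nothing, see airy4CE. *)
Definition airy4 (R : realType) (x : R) : R := complex.Re (airy4C x).

Definition pearcey (R : realType) (t x : R) : R[i] :=
  ((2 * pi)^-1)%:C *
  cintegral (fun l : R =>
    cexp ('i * l%:C * x%:C - 2^-1 * l%:C ^+ 2 * t%:C - l%:C ^+ 4 / 4)).

(* The difference quotient at t only uses points s of D with s != t, so for
   D = [0, +oo[ this is the right derivative at 0. *)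
Definition has_derivative_on (R : realType) (D : set R) (f f' : R -> R) : Prop :=
  forall t : R, D t ->
    (f s - f t) / (s - t) @[s --> within D t^'] --> f' t.

Lemma airy4_integrand (R : realType) (x y : R) :
  cexp ('i * x%:C * y%:C - y%:C ^+ 4 / 4) =
  (expR (- (y ^+ 4 / 4)) * cos (x * y)) +i*
  (expR (- (y ^+ 4 / 4)) * sin (x * y)).
Proof.
have -> : 'i * x%:C * y%:C - y%:C ^+ 4 / 4 = (- (y ^+ 4 / 4)) +i* (x * y) :> R[i].
  have -> : y%:C ^+ 4 / 4 = (y ^+ 4 / 4)%:C :> R[i].
    by rewrite rmorphM rmorphXn/= fmorphV/= rmorph_nat.
  rewrite -mulrA -rmorphM/=.
  by apply/eqP; rewrite eq_complex/= !(mul0r, mul1r, mulr0, subr0, add0r, addr0, oppr0, eqxx).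
rewrite /cexp/=.
by apply/eqP; rewrite eq_complex/= !(mul0r, mul1r, mulr0, subr0, add0r, addr0, eqxx).
Qed.

Lemma Rintegral_odd (R : realType) (g : R -> R) :
  measurable_fun [set: R] g -> (forall y, g (- y) = - g y) ->
  \int[@lebesgue_measure R]_y g y = 0.
Proof.
move=> mg godd; rewrite /Rintegral integralE.
set a := (X in (X - _)%E); set b := (X in (_ - X)%E).
suff -> : a = b.
  have : (0 <= b)%E by apply: integral_ge0 => y _; exact: funeneg_ge0.
  by case: b => //= r _; rewrite subrr.
rewrite {}/a {}/b.
have /measurable_EFinP mEg := mg.
have -> : ((fun y => (g y)%:E)^\- = (fun y => (g y)%:E)^\+ \o -%R)%E.
  by apply/funext => y; rewrite /= funenegE funeposE /= godd.
rewrite -[RHS](@ge0_integral_pushforward _ _ _ _ R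
  (-%R : measurableTypeR R -> measurableTypeR R) _ lebesgue_measure setT)//=.
- by apply: eq_measure_integral => A mA _; exact/esym/lebesgue_measureN.
- exact: measurable_funepos.
Qed.

Lemma airy4CE (R : realType) (x : R) : airy4C x = (airy4 x)%:C.
Proof.
suff im0 : complex.Im (airy4C x) = 0.
  by rewrite /airy4; move: im0; case: (airy4C x) => a b /= ->.
rewrite /airy4C (funext (airy4_integrand x)) /cintegral/= mul0r addr0.
rewrite Rintegral_odd ?mulr0// => [|y].
- apply: continuous_measurable_fun => y; apply: cvgM.
    apply: (@continuous_comp _ _ _ (fun z : R => - (z ^+ 4 / 4)) expR).
      by apply: cvgN; apply: cvgMr_tmp; exact: exprn_continuous.
    exact: continuous_expR.
  apply: (@continuous_comp _ _ _ (fun z : R => x * z) sin); last exact: continuous_sin.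
  by apply: cvgMl_tmp; exact: cvg_id.
- by rewrite mulrN sinN mulrN -[4%N]/(2 * 2)%N !exprM sqrrN.
Qed.

(* Main.v *)
Require Import Defs.
From mathcomp Require Import all_boot all_order all_algebra complex.
From mathcomp Require Import all_classical all_reals all_analysis.
From mathcomp Require Import measurable_realfun ring lra.

Import Order.TTheory GRing.Theory Num.Theory.
Import numFieldNormedType.Exports.

Local Open Scope classical_set_scope.
Local Open Scope ring_scope.

(** Put [v = v(t, x)]. It solves the heat equation [v_t = v_xx / 2], and
    integrating the derivative in [l] of [exp(- l^2 t / 2 - l^4 / 4) sin(l x)]
    over the line gives the third-order equation in space
    [v_xxx = x v + t v_x] ([moment_sin3]). So at every point all
    derivatives of [v] are determined by the jet [(v, v_x, v_xx)].

    Along a curve [x = f(t)] with slope [p = f'], consider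
    [w(t) = v(t, f(t))] and [z = w' = v_xx / 2 + p v_x]. If [f] solves the
    Rayleigh-type equation, then in [z'] the terms in [v_x] and [v_xx] combine
    into a multiple of [z]:
      [w' = z],   [z' = (1/4 + f p) w + (t / 2 + 2 p^2) z].
    This is a linear system, so [w] vanishes identically as soon as [w] and
    [z] vanish at [t = 0] ([jet0_along_rayleigh], by a Gronwall estimate).
    This route follows the given solution [f] and never constructs the zero
    curve of [v].

    At [t = 0] the condition [w = 0] is [phi(xi) = 0], and [z = 0] is the
    prescribed initial slope, provided that [phi'(xi) <> 0]: with a double zero
    the quotient defining the slope would be meaningless. Hence the zeros of
    [phi] have to be shown simple ([jet0_zero_simple]). The energy
    [E = v v_xx - v_x^2 / 2 - t v^2 / 2] has derivative [E_x = x v^2], by the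
    third-order equation. By parity, a double zero may be taken at some
    [x >= 0]. The energy vanishes there, so it is nonnegative to the right of
    it; it cannot be positive, because [v = O(1/x)] and [v_xx] is bounded. So
    [E = 0] to the right of [x], hence [v = 0] there, and by uniqueness for
    the third-order equation [v(t, 0) = 0]. But [v(t, 0)] is the integral of
    a positive function. *)

(** * The quartic weight and its trigonometric moments *)

Definition weight {R : realType} (t l : R) : R :=
  expR (- (l ^+ 2 * t / 2) - l ^+ 4 / 4).

Definition moment {R : realType} (g : R -> R) (k : nat) (t x : R) : R :=
  \int[@lebesgue_measure R]_l (l ^+ k * weight t l * g (l * x)).

Lemma weight_ge0 {R : realType} (t l : R) : 0 <= weight t l.
Proof. exact: expR_ge0. Qed.

(** The quartic term beats everything else: with [s = l^2], the bound
    [|l|^k <= exp(k (1 + s))] leaves the exponent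
    [k + (M + k + 1) s - s^2 / 4 - s <= k + (M + k + 1)^2 - s]. A fixed multiple
    of the Gaussian thus dominates all moment integrands with [|t| <= M],
    including negative [t], uniformly in [x]. *)
Lemma normX_weight_le {R : realType} (k : nat) (M t l : R) : `|t| <= M ->
  `|l| ^+ k * weight t l <=
    expR (k%:R + (M + k%:R + 1) ^+ 2) * gauss_fun l.
Proof.
move=> tM.
have lk : `|l| ^+ k <= expR (k%:R * (1 + l ^+ 2)).
  rewrite mulrC expRM_natr lerXn2r ?nnegrE ?expR_ge0//.
  apply: le_trans (expR_ge1Dx _).
  have := sqr_ge0 (`|l| - 1); rewrite sqrrB real_normK ?num_real// => ?.
  have := sqr_ge0 l; have := normr_ge0 l; nra.
apply: (le_trans (ler_wpM2r (weight_ge0 _ _) lk)).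
rewrite /weight /gauss_fun -!expRD ler_expR.
have l4 : l ^+ 4 = (l ^+ 2) ^+ 2 by rewrite -exprM.
rewrite {}l4; have := sqr_ge0 l; set s := l ^+ 2 => s0.
have tsM : - (s * t) <= s * M.
  by rewrite -mulrN ler_wpM2l// (le_trans (ler_norm _))// normrN.
have M0 : 0 <= M by exact: le_trans tM.
(* Completing the square in [(M + k + 1) s - s^2 / 4]. *)
have := sqr_ge0 (s / 2 - (M + k%:R + 1)).
have : 0 <= k%:R * s by rewrite mulr_ge0.
have : 0 <= s * M by rewrite mulr_ge0.
nra.
Qed.

Lemma measurable_momentf {R : realType} (g : R -> R) (k : nat) (t x : R) :
  continuous g ->
  measurable_fun [set: R] (fun l => l ^+ k * weight t l * g (l * x)).
Proof.
move=> cg.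
apply: continuous_measurable_fun => l; apply: cvgM; first apply: cvgM.
- exact: exprn_continuous.
- apply: continuous_comp; last exact: continuous_expR.
  apply: cvgB.
    apply: cvgN; apply: cvgM; last exact: cvg_cst.
    by apply: cvgM; [exact: exprn_continuous|exact: cvg_cst].
  by apply: cvgM; [exact: exprn_continuous|exact: cvg_cst].
- apply: (@continuous_comp _ _ _ (fun l : R => l * x) g); last exact: cg.
  by apply: cvgM; [exact: cvg_id|exact: cvg_cst].
Qed.

Lemma integrable_Zgauss {R : realType} (C : R) :
  (@lebesgue_measure R).-integrable setT (EFin \o (fun l => C * gauss_fun l)).
Proof.
have := integrableZl measurableT C (@integrableT_gauss R).
by apply: eq_integrable.
Qed.

Lemma momentf_le {R : realType} (g : R -> R) (k : nat) (M t x l : R) :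
  `|t| <= M -> (forall y, `|g y| <= 1) ->
  `|l ^+ k * weight t l * g (l * x)| <=
    expR (k%:R + (M + k%:R + 1) ^+ 2) * gauss_fun l.
Proof.
move=> tM g1; apply: le_trans (normX_weight_le k M t l tM).
rewrite !normrM normrX (ger0_norm (weight_ge0 _ _)) ler_piMr//.
by rewrite mulr_ge0 ?exprn_ge0 ?weight_ge0.
Qed.

Lemma integrable_momentf {R : realType} (g : R -> R) (k : nat) (t x : R) :
  continuous g -> (forall y, `|g y| <= 1) ->
  (@lebesgue_measure R).-integrable setT
    (EFin \o (fun l => l ^+ k * weight t l * g (l * x))).
Proof.
move=> cg g1.
set C := expR (k%:R + (`|t| + k%:R + 1) ^+ 2).
apply: le_integrable (integrable_Zgauss C) => //.
  by apply/measurable_EFinP; exact: measurable_momentf.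
move=> l _; rewrite /= lee_fin.
by rewrite (le_trans (momentf_le _ _ _ _ _ _ (lexx _) g1))// ler_norm.
Qed.

Lemma moment_bounded {R : realType} (g : R -> R) (k : nat) (t : R) :
  continuous g -> (forall y, `|g y| <= 1) ->
  exists2 B, 0 <= B & forall x, `|moment g k t x| <= B.
Proof.
move=> cg g1; set C := expR (k%:R + (`|t| + k%:R + 1) ^+ 2).
exists (\int[@lebesgue_measure R]_l (C * gauss_fun l)).
  by apply: Rintegral_ge0 => l _; rewrite mulr_ge0 ?expR_ge0 ?gauss_fun_ge0.
move=> x; apply: (le_trans (le_normr_Rintegral _ _)) => //.
  exact: integrable_momentf.
apply: le_Rintegral => //.
- have := integrable_momentf g k t x cg g1.
  by move=> /integrable_abse; apply: eq_integrable.
- exact: integrable_Zgauss.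
- by move=> l _; exact: momentf_le.
Qed.

(** * Differentiating moments along a curve *)

Lemma is_derive_continuous {R : realType} (f : R -> R) (x df : R) :
  is_derive x 1 f df -> {for x, continuous f}.
Proof. by move=> [] /derivable1_diffP/differentiable_continuous. Qed.

Lemma is_derive_momentf {R : realType} (g g' : R -> R) (k : nat)
    (tau xi : R -> R) (tau' xi' s l : R) :
  (forall y : R, is_derive y 1 g (g' y)) ->
  is_derive s 1 tau tau' -> is_derive s 1 xi xi' ->
  is_derive s 1 (fun s => l ^+ k * weight (tau s) l * g (l * xi s))
    (- (tau' / 2) * (l ^+ k.+2 * weight (tau s) l * g (l * xi s)) +
     xi' * (l ^+ k.+1 * weight (tau s) l * g' (l * xi s))).
Proof.
move=> dg dtau dxi.
have dw : is_derive s 1 (fun s => weight (tau s) l)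
    (weight (tau s) l * (- (l ^+ 2 * tau' / 2))).
  rewrite /weight.
  have de : is_derive s 1 (fun s => - (l ^+ 2 * tau s / 2) - l ^+ 4 / 4)
     (- (l ^+ 2 * tau' / 2)).
    have -> : (fun s => - (l ^+ 2 * tau s / 2) - l ^+ 4 / 4) =
       (- (l ^+ 2 / 2)) \*: tau - cst (l ^+ 4 / 4).
      by apply/funext => z; rewrite !fctE /= /GRing.scale /=; ring.
    apply: is_derive_eq; rewrite /GRing.scale/=; ring.
  apply: (is_derive_eq (is_derive1_comp (is_derive_expR _) de)).
  by rewrite /GRing.scale/=; ring.
have dgx : is_derive s 1 (fun s => g (l * xi s)) (g' (l * xi s) * (l * xi')).
  have dx : is_derive s 1 (fun s => l * xi s) (l * xi').
    have -> : (fun s => l * xi s) = l \*: xi by [].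
    by apply: is_derive_eq.
  apply: (is_derive_eq (is_derive1_comp (dg _) dx)).
  by rewrite /GRing.scale/=; ring.
have -> : (fun s => l ^+ k * weight (tau s) l * g (l * xi s)) =
  ((l ^+ k) \*: (fun s => weight (tau s) l)) * (fun s => g (l * xi s)).
  by apply/funext.
apply: is_derive_eq; rewrite /GRing.scale/= !exprS.
by rewrite -[_ *: _]/(_ * _); ring.
Qed.

(** Differentiation in [s] brings down a factor [l^2] from [tau] and a factor
    [l] from [xi]. Stating it along an arbitrary curve covers at once the
    derivative in [x] alone and the chain rule along [x = f(t)], without any
    two-variable calculus. *)
Lemma is_derive_moment {R : realType} (g g' : R -> R) (k : nat)
    (tau xi tau' xi' : R -> R) (u v M s : R) :
  (forall y : R, is_derive y 1 g (g' y)) -> continuous g' ->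
  (forall y, `|g y| <= 1) -> (forall y, `|g' y| <= 1) ->
  (forall r, u < r < v -> is_derive r 1 tau (tau' r)) ->
  (forall r, u < r < v -> is_derive r 1 xi (xi' r)) ->
  (forall r, u < r < v -> [/\ `|tau r| <= M, `|tau' r| <= M & `|xi' r| <= M]) ->
  u < s < v ->
  is_derive s 1 (fun r => moment g k (tau r) (xi r))
    (- (tau' s / 2) * moment g k.+2 (tau s) (xi s) +
     xi' s * moment g' k.+1 (tau s) (xi s)).
Proof.
move=> dg cg' g1 g'1 dtau dxi bd us.
have cg : continuous g by move=> y; exact: is_derive_continuous (dg y).
pose F r l := l ^+ k * weight (tau r) l * g (l * xi r).
have Is : `]u, v[%classic s by rewrite /= in_itv.
have intF r : `]u, v[%classic r ->
    (@lebesgue_measure R).-integrable setT (EFin \o F r).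
  by move=> _; exact: integrable_momentf.
have dF r l : `]u, v[%classic r -> is_derive r 1 (F ^~ l)
    (- (tau' r / 2) * (l ^+ k.+2 * weight (tau r) l * g (l * xi r)) +
     xi' r * (l ^+ k.+1 * weight (tau r) l * g' (l * xi r))).
  rewrite /= in_itv/= => ur; apply: is_derive_momentf => //; auto.
have d1F r l : `]u, v[%classic r -> partial1of2 F r l =
    - (tau' r / 2) * (l ^+ k.+2 * weight (tau r) l * g (l * xi r)) +
     xi' r * (l ^+ k.+1 * weight (tau r) l * g' (l * xi r)).
  by move=> ur; rewrite partial1of2E; have [_ ->] := dF _ l ur.
have derF r l : `]u, v[%classic r -> setT l -> derivable (F ^~ l) r 1.
  by move=> ur _; have [] := dF _ l ur.
pose C j := expR (j%:R + (M + j%:R + 1) ^+ 2).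
pose G l := (M * (C k.+2 + C k.+1)) * gauss_fun l.
have M0 : 0 <= M by have [+ _ _] := bd _ us; exact: le_trans.
have G0 l : 0 <= G l.
  by rewrite !mulr_ge0 ?gauss_fun_ge0 ?addr_ge0 ?expR_ge0.
have intG : (@lebesgue_measure R).-integrable setT (EFin \o G).
  exact: integrable_Zgauss.
have GF r l : `]u, v[%classic r -> setT l -> `|partial1of2 F r l| <= G l.
  move=> ur _; rewrite d1F//; move: ur; rewrite /= in_itv/= => /bd[b1 b2 b3].
  apply: (le_trans (ler_normD _ _)).
  have -> : G l = M * (C k.+2 * gauss_fun l) + M * (C k.+1 * gauss_fun l).
    by rewrite /G; ring.
  rewrite lerD// normrM ler_pM//.
  - rewrite normrN normrM [X in _ * X]ger0_norm//.
    by have := normr_ge0 (tau' r); lra.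
  - exact: momentf_le.
  - exact: momentf_le.
have eqF : \int[@lebesgue_measure R]_l partial1of2 F s l =
    (- (tau' s / 2) * moment g k.+2 (tau s) (xi s) +
     xi' s * moment g' k.+1 (tau s) (xi s)).
  rewrite /moment -!RintegralZl//; [|exact: integrable_momentf..].
  rewrite -RintegralD//; first by apply: eq_Rintegral => l _; rewrite d1F.
  - have := integrable_momentf g k.+2 (tau s) (xi s) cg g1.
    by move=> /(integrableZl measurableT (- (tau' s / 2))); apply: eq_integrable.
  - have := integrable_momentf g' k.+1 (tau s) (xi s) cg' g'1.
    by move=> /(integrableZl measurableT (xi' s)); apply: eq_integrable.
rewrite -eqF; split.
  exact: (derivable_under_integral measurableT Is intF derF G0 intG GF).
rewrite -derive1E.
exact: (differentiation_under_integral measurableT Is intF derF G0 intG GF).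
Qed.

Lemma is_derive_moment_space {R : realType} (g g' : R -> R) (k : nat)
    (t x : R) :
  (forall y : R, is_derive y 1 g (g' y)) -> continuous g' ->
  (forall y, `|g y| <= 1) -> (forall y, `|g' y| <= 1) ->
  is_derive x 1 (moment g k t) (moment g' k.+1 t x).
Proof.
move=> dg cg' g1 g'1.
have := @is_derive_moment R g g' k (cst t) id (cst 0) (cst 1) (x - 1) (x + 1)
  (`|t| + 1) x dg cg' g1 g'1.
rewrite mul0r oppr0 mul0r add0r mul1r; apply.
- by move=> r _; rewrite normr0 normr1; have := normr_ge0 t; split; lra.
- by lra.
Qed.

(** Needed besides differentiability because the curve of interest, once
    extended to negative times, is only continuous at [0]. *)
Lemma continuous_moment_curve {R : realType} (g : R -> R) (k : nat)
    (xi : R -> R) :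
  continuous g -> (forall y, `|g y| <= 1) -> continuous xi ->
  continuous (fun s => moment g k s (xi s)).
Proof.
move=> cg g1 cxi s.
pose F r l := l ^+ k * weight r l * g (l * xi r).
have Is : s \in `]s - 1, s + 1[%classic by rewrite inE/= in_itv/=; lra.
apply: (@continuity_under_integral R _ _ (@lebesgue_measure R) F setT
  measurableT (s - 1) (s + 1) _ _ _ _ _ _ Is).
- by move=> r _; exact: integrable_momentf.
- apply/aeW => l _ r _; rewrite /F; apply: cvgM; first apply: cvgM.
  + exact: cvg_cst.
  + apply: continuous_comp; last exact: continuous_expR.
    apply: cvgB; last exact: cvg_cst.
    apply: cvgN; apply: cvgM; last exact: cvg_cst.
    by apply: cvgM; [exact: cvg_cst|exact: cvg_id].
  + apply: (@continuous_comp _ _ _ (fun r => l * xi r) g); last exact: cg.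
    by apply: cvgM; [exact: cvg_cst|exact: cxi].
- exact: (integrable_Zgauss (expR (k%:R + (`|s| + 1 + k%:R + 1) ^+ 2))).
- move=> r; rewrite /= in_itv/= => rs; apply/aeW => l _.
  apply: momentf_le => //.
  by have := ler_norm s; have := ler_norm (- s); rewrite normrN ler_norml; lra.
Qed.

(** * Integration by parts on the line *)

(** The fundamental theorem of calculus on [[- n, n]] and dominated convergence:
    the Gaussian bound kills the boundary terms. *)
Lemma Rintegral_derive_eq0 {R : realType} (F f : R -> R) (C : R) :
  (forall l : R, is_derive l 1 F (f l)) -> continuous f ->
  (@lebesgue_measure R).-integrable setT (EFin \o f) ->
  (forall l, `|F l| <= C * gauss_fun l) ->
  \int[@lebesgue_measure R]_l f l = 0.
Proof.
move=> dF cf intf FC.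
have C0 : 0 <= C.
  have := FC 0; rewrite /gauss_fun expr0n/= oppr0 expR0 mulr1.
  exact: le_trans.
pose I n : set R := `[- n.+1%:R, n.+1%:R]%classic.
have FTC (n : nat) : (\int[@lebesgue_measure R]_(l in I n) (f l)%:E =
    (F n.+1%:R - F (- n.+1%:R))%:E)%E.
  apply: continuous_FTC2.
  - by rewrite gtrN// ltr0n.
  - exact: continuous_subspaceT.
  - split.
    + by move=> l _; have [] := dF l.
    + by apply: cvg_at_right_filter; exact: is_derive_continuous (dF _).
    + by apply: cvg_at_left_filter; exact: is_derive_continuous (dF _).
  - by move=> l _; rewrite derive1E; have [] := dF l.
have cvgf : (\int[@lebesgue_measure R]_(l in I n) (f l)%:E @[n --> \oo] -->
    \int[@lebesgue_measure R]_l (f l)%:E)%E.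
  under eq_fun do rewrite integral_mkcond.
  apply: (@dominated_cvg _ _ _ (@lebesgue_measure R) setT measurableT
    (fun n => (EFin \o f) \_ (I n)) (EFin \o f)
    (abse \o (EFin \o f))) => //.
  - move=> n; apply/(measurable_restrictT _ _).1 => //.
      exact: measurable_itv.
    apply: measurable_funTS; apply/measurable_EFinP.
    exact: continuous_measurable_fun.
  - move=> l _; apply: cvg_near_cst.
    near=> n; rewrite patchT// inE /I/= in_itv/= -ler_norml.
    near: n; exists (Num.truncn `|l|) => // n /= ln.
    by rewrite (le_trans (ltW (truncnS_gt _)))// ler_nat ltnS.
  - exact: integrable_abse.
  - move=> n l _; rewrite patchE; case: ifPn => // _.
    by rewrite abse0; exact: abse_ge0.
transitivity (fine (0 : \bar R)) => //; congr fine.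
apply: cvg_unique cvgf _; first exact: ereal_hausdorff.
rewrite /= [X in X @ _ --> _](_ : _ =
    (fun n => (F n.+1%:R - F (- n.+1%:R))%:E)); last exact/funext.
apply: cvg_EFin; first exact: nearW.
apply: norm_cvg0.
apply: (@squeeze_cvgr _ _ _ _ (cst 0)
  (fun n : nat => 2 * C * gauss_fun n.+1%:R)).
- apply: nearW => n /=; rewrite normr_ge0/= (le_trans (ler_normB _ _))//.
  have := FC n.+1%:R; have := FC (- n.+1%:R).
  by rewrite /gauss_fun sqrrN; lra.
- exact: cvg_cst.
- rewrite -[X in _ --> X](mulr0 (2 * C)); apply: cvgM; first exact: cvg_cst.
  apply: (cvg_comp _ _ _ cvg_gauss_fun).
  rewrite (cvg_shiftS (fun n => n%:R : R)).
  exact: cvgr_idn.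
Unshelve. all: by end_near.
Qed.

(** * The third-order equation in space *)

Lemma momentN {R : realType} (g : R -> R) (k : nat) (t x : R) :
  continuous g -> (forall y, `|g y| <= 1) ->
  moment (fun y => - g y) k t x = - moment g k t x.
Proof.
move=> cg g1; rewrite /moment -mulN1r -RintegralZl//.
  by apply: eq_Rintegral => l _; rewrite mulN1r mulrN.
exact: integrable_momentf.
Qed.

Lemma normr_cos_le1 {R : realType} (y : R) : `|cos y| <= 1.
Proof. by rewrite ler_norml cos_geN1 cos_le1. Qed.

Lemma normr_sin_le1 {R : realType} (y : R) : `|sin y| <= 1.
Proof. by rewrite ler_norml sin_geN1 sin_le1. Qed.

(** In the notation of the jet below: [v_xxx = x v + t v_x]. It says that
    [weight t l * sin (l x)] has a derivative in [l] of zero integral. *)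
Lemma moment_sin3 {R : realType} (t x : R) :
  moment sin 3 t x = x * moment cos 0 t x - t * moment sin 1 t x.
Proof.
pose f l := x * (l ^+ 0 * weight t l * cos (l * x)) +
  ((- t) * (l ^+ 1 * weight t l * sin (l * x)) +
   (- 1) * (l ^+ 3 * weight t l * sin (l * x))).
have ci k : (@lebesgue_measure R).-integrable setT
    (EFin \o (fun l => l ^+ k * weight t l * cos (l * x))).
  by apply: integrable_momentf; [exact: continuous_cos|exact: normr_cos_le1].
have si k : (@lebesgue_measure R).-integrable setT
    (EFin \o (fun l => l ^+ k * weight t l * sin (l * x))).
  by apply: integrable_momentf; [exact: continuous_sin|exact: normr_sin_le1].
have Zi (h : R -> R) c : (@lebesgue_measure R).-integrable setT (EFin \o h) ->
    (@lebesgue_measure R).-integrable setT (EFin \o (fun l => c * h l)).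
  by move=> hi; have := integrableZl measurableT c hi; apply: eq_integrable.
have Di (h1 h2 : R -> R) :
    (@lebesgue_measure R).-integrable setT (EFin \o h1) ->
    (@lebesgue_measure R).-integrable setT (EFin \o h2) ->
    (@lebesgue_measure R).-integrable setT (EFin \o (fun l => h1 l + h2 l)).
  by move=> i1 i2; have := integrableD measurableT i1 i2; apply: eq_integrable.
have dw (l : R) : is_derive l 1 (weight t) (weight t l * (- (l * t) - l ^+ 3)).
  have de : is_derive l 1 (fun l => - (l ^+ 2 * t / 2) - l ^+ 4 / 4)
      (- (l * t) - l ^+ 3).
    have -> : (fun l => - (l ^+ 2 * t / 2) - l ^+ 4 / 4) =
        (- (t / 2)) \*: (@id R) ^+ 2 - 4^-1 \*: (@id R) ^+ 4.
      by apply/funext => z; rewrite !fctE /= /GRing.scale /=; ring.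
    by apply: is_derive_eq; rewrite /GRing.scale/=; field.
  by apply: (is_derive_eq (is_derive1_comp (is_derive_expR _) de)).
have ds (l : R) : is_derive l 1 (fun l => sin (l * x)) (x * cos (l * x)).
  have dx : is_derive l 1 (fun l => l * x) x.
    have -> : (fun l => l * x) = x \*: (@id R).
      by apply/funext => z; rewrite mulrC.
    by apply: is_derive_eq; rewrite /GRing.scale/= mulr1.
  apply: (is_derive_eq (is_derive1_comp (is_derive_sin _) dx)).
  by rewrite mulrC.
have dF (l : R) : is_derive l 1 (weight t * (fun l => sin (l * x))) (f l).
  by apply: is_derive_eq; rewrite /f /GRing.scale/=; ring.
have cw : continuous (weight t) by move=> l; exact: is_derive_continuous (dw l).
have cs : continuous (fun l : R => sin (l * x)).
  by move=> l; exact: is_derive_continuous (ds l).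
have cc : continuous (fun l : R => cos (l * x)).
  move=> l; apply: (@continuous_comp _ _ _ (fun l : R => l * x) cos).
    by apply: cvgM; [exact: cvg_id|exact: cvg_cst].
  exact: continuous_cos.
have cp k : continuous (fun l : R => l ^+ k * weight t l).
  by move=> l; apply: cvgM; [exact: exprn_continuous|exact: cw].
have cf : continuous f.
  move=> l; apply: cvgD; [|apply: cvgD]; apply: cvgM; try exact: cvg_cst;
  apply: cvgM; try exact: cp.
  - exact: cc.
  - exact: cs.
  - exact: cs.
have intf : (@lebesgue_measure R).-integrable setT (EFin \o f).
  by apply: (Di); [|apply: (Di)]; exact: (Zi).
have bF (l : R) : `|(weight t * (fun l => sin (l * x))) l| <=
    expR (0%:R + (`|t| + 0%:R + 1) ^+ 2) * gauss_fun l.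
  have := momentf_le sin 0 `|t| t x l (lexx _) normr_sin_le1.
  by rewrite expr0 mul1r.
have := Rintegral_derive_eq0 _ _ _ dF cf intf bF.
rewrite /f RintegralD//; [|exact: Zi|by apply: Di; exact: Zi].
rewrite RintegralD//; [|exact: Zi|exact: Zi].
rewrite !RintegralZl//.
by rewrite -/(moment cos 0 t x) -!/(moment sin _ t x); lra.
Qed.

(** The jet [(v, v_x, v_xx)] of the real-valued Pearcey integral, without the
    factor [1 / (2 pi)]. *)
Definition jet0 {R : realType} (t x : R) : R := moment cos 0 t x.
Definition jet1 {R : realType} (t x : R) : R := - moment sin 1 t x.
Definition jet2 {R : realType} (t x : R) : R := - moment cos 2 t x.

Lemma continuous_oppsin {R : realType} : continuous (fun y : R => - sin y).
Proof. by move=> y; apply: cvgN; exact: continuous_sin. Qed.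

Lemma normr_oppsin_le1 {R : realType} (y : R) : `|- sin y| <= 1.
Proof. by rewrite normrN normr_sin_le1. Qed.

Lemma is_derive_momentcos {R : realType} (k : nat) (t x : R) :
  is_derive x 1 (moment cos k t) (- moment sin k.+1 t x).
Proof.
rewrite -momentN; [|exact: continuous_sin|exact: normr_sin_le1].
apply: is_derive_moment_space => *; [exact: continuous_oppsin|
  exact: normr_cos_le1|exact: normr_oppsin_le1].
Qed.

Lemma is_derive_momentsin {R : realType} (k : nat) (t x : R) :
  is_derive x 1 (moment sin k t) (moment cos k.+1 t x).
Proof.
apply: is_derive_moment_space => *; [exact: continuous_cos|
  exact: normr_sin_le1|exact: normr_cos_le1].
Qed.

Lemma is_derive_jet0 {R : realType} (t x : R) :
  is_derive x 1 (jet0 t) (jet1 t x).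
Proof. exact: is_derive_momentcos. Qed.

Lemma is_derive_jet1 {R : realType} (t x : R) :
  is_derive x 1 (jet1 t) (jet2 t x).
Proof. by have ? := is_derive_momentsin 1 t x; apply: is_deriveN. Qed.

Lemma is_derive_jet2 {R : realType} (t x : R) :
  is_derive x 1 (jet2 t) (x * jet0 t x + t * jet1 t x).
Proof.
have ? := is_derive_momentcos 2 t x.
apply: (is_derive_eq (is_deriveN _)).
by rewrite moment_sin3 /jet0 /jet1; ring.
Qed.

(** This is [v_xxxx], so it is the space derivative of [moment_sin3]. *)
Lemma moment_cos4 {R : realType} (t x : R) :
  moment cos 4 t x = jet0 t x + x * jet1 t x + t * jet2 t x.
Proof.
have [_ <-] := is_derive_momentsin 3 t x.
have -> : moment sin 3 t = id * jet0 t + t \*: jet1 t.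
  apply/funext => z; rewrite moment_sin3 !fctE /jet0 /jet1.
  by rewrite /= -[t *: _]/(t * _); ring.
have ? := is_derive_jet0 t x; have ? := is_derive_jet1 t x.
apply: derive_val; apply: is_derive_eq; rewrite /GRing.scale/=; ring.
Qed.

(** * A one-sided Gronwall inequality *)

(** [N x * exp (- K x)] is nonincreasing on [[a, b]]. *)
Lemma gronwall_le0 {R : realType} (N dN : R -> R) (K a b : R) :
  a <= b -> {within `[a, b], continuous N} ->
  (forall x, a < x < b -> is_derive x 1 N (dN x)) ->
  (forall x, a < x < b -> dN x <= K * N x) ->
  N a <= 0 -> N b <= 0.
Proof.
move=> ab cN dNx dNle Na.
have de (x : R) :
    is_derive x 1 (fun y => expR (- K * y)) (- K * expR (- K * x)).
  have dx : is_derive x 1 (fun y => - K * y) (- K).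
    have -> : (fun y => - K * y) = (- K) \*: (@id R) by [].
    by apply: is_derive_eq; rewrite /GRing.scale/= mulr1.
  apply: (is_derive_eq (is_derive1_comp (is_derive_expR _) dx)).
  by rewrite mulrC.
pose h := N * (fun y => expR (- K * y)).
have dh x : a < x < b -> is_derive x 1 h ((dN x - K * N x) * expR (- K * x)).
  move=> xab; have ? := dNx _ xab.
  by rewrite /h; apply: is_derive_eq; rewrite /GRing.scale/=; ring.
have : h b <= h a.
  apply: (@ler0_derive1_nincr _ h a b) => //.
  - by move=> x; rewrite in_itv/= => /dh[].
  - move=> x; rewrite in_itv/= => xab; rewrite derive1E.
    have [_ ->] := dh _ xab.
    by rewrite mulr_le0_ge0 ?expR_ge0// subr_le0 dNle.
  - move=> x; apply: cvgM; first exact: cN.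
    apply: continuous_subspaceT => y; exact: is_derive_continuous (de y).
have ha : h a <= 0 by rewrite /h mulr_le0_ge0 ?expR_ge0.
move=> /le_trans/(_ ha); rewrite /h !fctE pmulr_lle0//; exact: expR_gt0.
Qed.

(** * The jet along a curve, and its symmetries *)

(** The total derivatives of [v, v_x, v_xx] along [x = xi(t)]: time derivatives
    are halves of second space derivatives, and those of order three and four
    are rewritten in terms of the jet. *)
Lemma is_derive_jet_curve {R : realType} (xi xi' : R -> R) (u v M s : R) :
  (forall r, u < r < v -> is_derive r 1 xi (xi' r)) ->
  (forall r, u < r < v -> `|r| <= M /\ `|xi' r| <= M) -> u < s < v ->
  [/\ is_derive s 1 (fun r => jet0 r (xi r))
        (jet2 s (xi s) / 2 + xi' s * jet1 s (xi s)),
      is_derive s 1 (fun r => jet1 r (xi r))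
        ((xi s * jet0 s (xi s) + s * jet1 s (xi s)) / 2 +
         xi' s * jet2 s (xi s)) &
      is_derive s 1 (fun r => jet2 r (xi r))
        ((jet0 s (xi s) + xi s * jet1 s (xi s) + s * jet2 s (xi s)) / 2 +
         xi' s * (xi s * jet0 s (xi s) + s * jet1 s (xi s)))].
Proof.
move=> dxi bd us.
have bd' r : u < r < v ->
    [/\ `|r| <= M + 1, `|cst (1 : R) r| <= M + 1 & `|xi' r| <= M + 1].
  move=> ur; have [rM xM] := bd r ur; rewrite /cst normr1.
  by have := normr_ge0 r; split; lra.
have Dc k : is_derive s 1 (fun r => moment cos k r (xi r))
    (- (1 / 2) * moment cos k.+2 s (xi s) - xi' s * moment sin k.+1 s (xi s)).
  rewrite -[- (xi' s * _)]mulrN -momentN;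
    [|exact: continuous_sin|exact: normr_sin_le1].
  apply: (@is_derive_moment _ cos (fun y => - sin y) k id xi (cst 1) xi' u v
    (M + 1)) => // *.
  - exact: continuous_oppsin.
  - exact: normr_cos_le1.
  - exact: normr_oppsin_le1.
have Ds k : is_derive s 1 (fun r => moment sin k r (xi r))
    (- (1 / 2) * moment sin k.+2 s (xi s) + xi' s * moment cos k.+1 s (xi s)).
  apply: (@is_derive_moment _ sin cos k id xi (cst 1) xi' u v (M + 1)) => // *.
  - exact: continuous_cos.
  - exact: normr_sin_le1.
  - exact: normr_cos_le1.
split.
- by apply: (is_derive_eq (Dc 0)); rewrite /jet1 /jet2; field.
- have ? := Ds 1.
  apply: (is_derive_eq (is_deriveN _)).
  by rewrite moment_sin3 /jet2 /jet0 /jet1; field.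
- have ? := Dc 2.
  apply: (is_derive_eq (is_deriveN _)).
  by rewrite moment_sin3 moment_cos4 /jet2 /jet0 /jet1; field.
Qed.

Lemma jet0N {R : realType} (t x : R) : jet0 t (- x) = jet0 t x.
Proof. by apply: eq_Rintegral => l _; rewrite mulrN cosN. Qed.

Lemma jet2N {R : realType} (t x : R) : jet2 t (- x) = jet2 t x.
Proof.
by rewrite /jet2; congr -%R; apply: eq_Rintegral => l _; rewrite mulrN cosN.
Qed.

Lemma jet1N {R : realType} (t x : R) : jet1 t (- x) = - jet1 t x.
Proof.
rewrite /jet1; congr -%R; rewrite -[RHS]momentN.
- by apply: eq_Rintegral => l _; rewrite mulrN sinN.
- exact: continuous_sin.
- exact: normr_sin_le1.
Qed.

Lemma jet0_origin_gt0 {R : realType} (t : R) : 0 <= t -> 0 < jet0 t 0.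
Proof.
move=> t0.
(* The minimum of the weight on [[0, 1]]. *)
pose c : R := expR (- (t / 2) - 1 / 4).
suff : c <= jet0 t 0 by apply: lt_le_trans; exact: expR_gt0.
have intw : (@lebesgue_measure R).-integrable setT
    (EFin \o (fun l => l ^+ 0 * weight t l * cos (l * 0))).
  by apply: integrable_momentf; [exact: continuous_cos|exact: normr_cos_le1].
have w0 l : 0 <= l ^+ 0 * weight t l * cos (l * 0).
  by rewrite expr0 mul1r mulr0 cos0 mulr1 weight_ge0.
have mw := measurable_int _ intw.
rewrite -lee_fin /jet0 /moment /Rintegral fineK; last exact: integrable_fin_num.
apply: (@le_trans _ _ (\int[@lebesgue_measure R]_(l in `[0%R, 1%R])
    (l ^+ 0 * weight t l * cos (l * 0))%:E)%E); last first.
  apply: ge0_subset_integral => //.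
  by move=> l _; rewrite lee_fin.
apply: (@le_trans _ _ (\int[@lebesgue_measure R]_(l in `[0%R, 1%R]) c%:E)%E).
  rewrite integral_cst//= lebesgue_measure_itv/= lte_fin ltr01 -EFinB subr0.
  by rewrite mule1.
apply: ge0_le_integral => //.
- by move=> l _; rewrite lee_fin expR_ge0.
- exact: measurable_funTS.
- move=> l; rewrite /= in_itv/= => /andP[l0 l1].
  rewrite lee_fin expr0 mul1r mulr0 cos0 mulr1 ler_expR.
  have l2 : l ^+ 2 <= 1 by rewrite exprn_ile1.
  have l4 : l ^+ 4 <= 1 by rewrite exprn_ile1.
  have : l ^+ 2 * t <= t by rewrite ler_piMl.
  lra.
Qed.

(** * Zeros are simple *)

(** The third-order equation is a linear system for the jet, so the squared
    norm of the jet satisfies a Gronwall inequality. *)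
Lemma jet0_eq0_propagates {R : realType} (t a b : R) : a <= b ->
  jet0 t a = 0 -> jet1 t a = 0 -> jet2 t a = 0 -> jet0 t b = 0.
Proof.
move=> ab a0 a1 a2.
pose N := jet0 t ^+ 2 + jet1 t ^+ 2 + jet2 t ^+ 2.
pose dN x := 2 * (jet0 t x * jet1 t x + jet1 t x * jet2 t x +
  jet2 t x * (x * jet0 t x + t * jet1 t x)).
have dNx (x : R) : is_derive x 1 N (dN x).
  have sq (f : R -> R) df : is_derive x 1 f df ->
      is_derive x 1 (f ^+ 2) (2 * f x * df).
    by move=> ?; apply: is_derive_eq.
  apply: (is_derive_eq (is_deriveD (is_deriveD (sq _ _ (is_derive_jet0 t x))
    (sq _ _ (is_derive_jet1 t x))) (sq _ _ (is_derive_jet2 t x)))).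
  by rewrite /dN; ring.
have : N b <= 0.
  apply: (@gronwall_le0 _ N dN (2 + (`|a| + `|b|) + `|t|) a b) => //.
  - by apply: continuous_subspaceT => x; exact: is_derive_continuous (dNx x).
  - move=> x /andP[ax xb].
    rewrite /N /dN !fctE.
    set p := jet0 t x; set q := jet1 t x; set r := jet2 t x.
    have xab : `|x| <= `|a| + `|b|.
      have := ler_norm b; have := ler_norm (- a); rewrite normrN => ? ?.
      by rewrite ler_norml; have := normr_ge0 a; have := normr_ge0 b; lra.
    have cross (c u w : R) : 2 * (c * (u * w)) <= `|c| * (u ^+ 2 + w ^+ 2).
      have := sqr_ge0 (u - w); have := sqr_ge0 (u + w).
      by case: (ger0P c) => c0; nra.
    have h1 := cross 1 p q; have h2 := cross 1 q r; have h3 := cross x r p.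
    have h4 := cross t r q; rewrite normr1 in h1 h2.
    have p0 := sqr_ge0 p; have q0 := sqr_ge0 q; have r0 := sqr_ge0 r.
    have : `|x| * (r ^+ 2 + p ^+ 2) <=
        (`|a| + `|b|) * (p ^+ 2 + q ^+ 2 + r ^+ 2).
      by rewrite ler_pM//; lra.
    have : `|t| * (r ^+ 2 + q ^+ 2) <= `|t| * (p ^+ 2 + q ^+ 2 + r ^+ 2).
      by rewrite ler_wpM2l//; lra.
    by lra.
  - by rewrite /N !fctE a0 a1 a2 expr0n/= !addr0.
rewrite /N !fctE => Nb; apply/eqP; rewrite -sqrf_eq0; apply/eqP.
have := sqr_ge0 (jet0 t b); have := sqr_ge0 (jet1 t b).
by have := sqr_ge0 (jet2 t b); lra.
Qed.

(** [x v = v_xxx - t v_x] is a combination of bounded moments. *)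
Lemma jet0_decay {R : realType} (t : R) :
  exists2 B, 0 <= B & forall x, 0 < x -> `|jet0 t x| * x <= B.
Proof.
have [B1 B10 h1] := moment_bounded sin 1 t (@continuous_sin R) normr_sin_le1.
have [B3 B30 h3] := moment_bounded sin 3 t (@continuous_sin R) normr_sin_le1.
exists (B3 + `|t| * B1) => [|x x0]; first by rewrite addr_ge0 ?mulr_ge0.
rewrite -[X in _ * X](ger0_norm (ltW x0)) -normrM.
have -> : jet0 t x * x = moment sin 3 t x + t * moment sin 1 t x.
  by rewrite moment_sin3 /jet0; ring.
by rewrite (le_trans (ler_normD _ _))// lerD// normrM ler_wpM2l.
Qed.

(** The last term is what makes the derivative [x v^2] a multiple of [x]: the
    part [t v v_x] of [v v_xxx] is an exact derivative. *)
Definition jet_energy {R : realType} (t x : R) : R :=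
  jet0 t x * jet2 t x - jet1 t x ^+ 2 / 2 - t * jet0 t x ^+ 2 / 2.

Lemma is_derive_jet_energy {R : realType} (t x : R) :
  is_derive x 1 (jet_energy t) (x * jet0 t x ^+ 2).
Proof.
have ? := is_derive_jet0 t x; have ? := is_derive_jet1 t x.
have ? := is_derive_jet2 t x.
have -> : jet_energy t = jet0 t * jet2 t - 2^-1 \*: jet1 t ^+ 2 -
    (t / 2) \*: jet0 t ^+ 2.
  by apply/funext => z; rewrite /jet_energy !fctE/= -![_ *: _]/(_ * _); ring.
by apply: is_derive_eq; rewrite /GRing.scale/=; field.
Qed.

Lemma jet_energy_ndecr {R : realType} (t x y : R) : 0 <= x -> x <= y ->
  jet_energy t x <= jet_energy t y.
Proof.
move=> x0 xy.
apply: (@ger0_derive1_ndecry _ (jet_energy t) 0) => //.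
- by move=> z _; have [] := is_derive_jet_energy t z.
- move=> z; rewrite in_itv/= andbT => z0; rewrite derive1E.
  have [_ ->] := is_derive_jet_energy t z.
  by rewrite mulr_ge0 ?sqr_ge0// ltW.
- apply: continuous_subspaceT => z.
  exact: is_derive_continuous (is_derive_jet_energy t z).
Qed.

(** If the energy were [c > 0] at some [x], it would stay above [c] to the
    right, so [v v_xx >= c] there; but [v] decays and [v_xx] is bounded. *)
Lemma jet_energy_le0 {R : realType} (t x : R) : 0 <= t -> 0 <= x ->
  jet_energy t x <= 0.
Proof.
move=> t0 x0; rewrite leNgt; apply/negP => c0.
have [A A0 hA] := moment_bounded cos 2 t (@continuous_cos R) normr_cos_le1.
have [B B0 hB] := jet0_decay t.
set c := jet_energy t x in c0.
(* Far enough that [c * y > A * B], against [c <= A |v|] and [|v| y <= B]. *)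
pose y := x + 1 + A * B / c.
have ABc : 0 <= A * B / c by rewrite divr_ge0 ?mulr_ge0// ltW.
have y0 : 0 < y by rewrite /y; lra.
have cy : c <= jet_energy t y by apply: jet_energy_ndecr => //; rewrite /y; lra.
have cA : c <= A * `|jet0 t y|.
  apply: (le_trans cy); apply: (@le_trans _ _ (jet0 t y * jet2 t y)).
    have := sqr_ge0 (jet1 t y); have : 0 <= t * jet0 t y ^+ 2.
      by rewrite mulr_ge0 ?sqr_ge0.
    by rewrite /jet_energy; lra.
  by rewrite (le_trans (ler_norm _))// normrM mulrC ler_wpM2r// /jet2 normrN.
have : c * y <= A * B.
  apply: (@le_trans _ _ (A * `|jet0 t y| * y)).
    by rewrite ler_wpM2r// ltW.
  by rewrite -mulrA ler_wpM2l// hB.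
rewrite leNgt => /negP; apply.
rewrite /y mulrDr [c * (_ / c)]mulrC divfK ?gt_eqF// ltrDr.
by rewrite mulr_gt0//; lra.
Qed.

Lemma derive_eq0_right {R : realType} (f : R -> R) (df x0 x : R) :
  (forall y, x0 < y -> f y = 0) -> x0 < x -> is_derive x 1 f df -> df = 0.
Proof.
move=> f0 x0x fdf.
have h : is_derive x 1 f 0.
  apply: (near_eq_is_derive (f := cst 0)).
  by near=> y; rewrite f0//; near: y; exact: lt_nbhsr.
by have [_ <-] := fdf; have [_ ->] := h.
Unshelve. all: by end_near.
Qed.

(** By parity, take the double zero at [x >= 0]. There the energy is [0], hence
    it is [0] to the right, hence so is [v]. Uniqueness is then applied from
    [- (x + 1)], where the jet vanishes by parity, forward to [0]. *)
Lemma jet0_zero_simple {R : realType} (t x : R) : 0 <= t ->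
  jet0 t x = 0 -> jet1 t x != 0.
Proof.
move=> t0; wlog x0 : x / 0 <= x.
  move=> wl; have [x0|/ltW x0] := leP 0 x; first exact: wl.
  have := wl (- x); rewrite oppr_ge0 jet0N jet1N oppr_eq0 => /(_ x0).
  exact.
move=> px0; apply/eqP => px1.
have E0 y : x < y -> jet_energy t y = 0.
  move=> xy; apply/le_anti; rewrite jet_energy_le0 ?(le_trans x0 (ltW xy))//=.
  have := jet_energy_ndecr t x y x0 (ltW xy).
  by rewrite {1}/jet_energy px0 px1 mul0r !expr0n/= mulr0 !mul0r !subr0.
have P0 y : x < y -> jet0 t y = 0.
  move=> xy; have := derive_eq0_right _ _ _ _ E0 xy (is_derive_jet_energy t y).
  move/eqP; rewrite mulf_eq0 sqrf_eq0 gt_eqF//=; last exact: le_lt_trans xy.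
  by move/eqP.
have P1 y : x < y -> jet1 t y = 0.
  by move=> xy; exact: derive_eq0_right _ _ _ _ P0 xy (is_derive_jet0 t y).
have P2 y : x < y -> jet2 t y = 0.
  by move=> xy; exact: derive_eq0_right _ _ _ _ P1 xy (is_derive_jet1 t y).
have xx1 : x < x + 1 by lra.
have := jet0_origin_gt0 t t0.
rewrite (@jet0_eq0_propagates _ t (- (x + 1)) 0) ?ltxx//.
- by lra.
- by rewrite jet0N P0.
- by rewrite jet1N P1// oppr0.
- by rewrite jet2N P2.
Qed.

(** * The complex integrals as moments *)

Lemma pearcey_integrand {R : realType} (t x l : R) :
  cexp ('i * l%:C * x%:C - 2^-1 * l%:C ^+ 2 * t%:C - l%:C ^+ 4 / 4)%C =
  ((l ^+ 0 * weight t l * cos (l * x)) +i*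
   (l ^+ 0 * weight t l * sin (l * x)))%C.
Proof.
have -> : ('i * l%:C * x%:C - 2^-1 * l%:C ^+ 2 * t%:C - l%:C ^+ 4 / 4 =
    (- (l ^+ 2 * t / 2) - l ^+ 4 / 4) +i* (l * x) :> R[i])%C.
  have -> : (l%:C ^+ 4 / 4 = (l ^+ 4 / 4)%:C :> R[i])%C.
    by rewrite rmorphM rmorphXn/= fmorphV/= rmorph_nat.
  have -> : (2^-1 * l%:C ^+ 2 * t%:C = (l ^+ 2 * t / 2)%:C :> R[i])%C.
    rewrite !rmorphM/= fmorphV/= rmorph_nat; ring.
  rewrite -mulrA -rmorphM/=.
  apply/eqP; rewrite eq_complex/=.
  by rewrite !(mul0r, mul1r, mulr0, subr0, add0r, addr0, oppr0) !eqxx.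
rewrite /cexp/= -/(weight t l).
by apply/eqP; rewrite eq_complex/= !(mul0r, mul1r, expr0, subr0, addr0, eqxx).
Qed.

Lemma pearceyE {R : realType} (t x : R) :
  pearcey t x = ((2 * pi)^-1 * jet0 t x)%:C%C.
Proof.
rewrite /pearcey (funext (pearcey_integrand t x)) /cintegral/=.
rewrite (_ : (\int[@lebesgue_measure R]_y
    (y ^+ 0 * weight t y * sin (y * x)))%R = 0).
  by rewrite -/(moment cos 0 t x) -/(jet0 t x) -rmorphM.
apply: Rintegral_odd => [|y].
  exact: measurable_momentf (@continuous_sin R).
by rewrite mulNr sinN mulrN /weight !sqrrN -[4%N]/(2 * 2)%N !exprM sqrrN !expr0.
Qed.

(** [phi] is the initial value of [v], so it inherits the jet at [t = 0]. *)
Lemma airy4E {R : realType} : @airy4 R = (2 * pi)^-1 \*: jet0 0.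
Proof.
apply/funext => x.
have : airy4C x = pearcey 0 x.
  rewrite /airy4C /pearcey; congr (_ * cintegral _); apply/funext => y.
  by congr cexp; rewrite mulr0 subr0 [_ * x%:C%C * _]mulrAC.
by rewrite airy4CE pearceyE => /complexI.
Qed.

Lemma derive_airy4 {R : realType} (x : R) :
  ((@airy4 R)^`(1))%classic x = (2 * pi)^-1 * jet1 0 x /\
  ((@airy4 R)^`(2))%classic x = (2 * pi)^-1 * jet2 0 x.
Proof.
have d1 : ((@airy4 R)^`(1))%classic = (2 * pi)^-1 \*: jet1 0.
  apply/funext => y; rewrite /= derive1E airy4E.
  by have ? := is_derive_jet0 0 y; apply: derive_val.
split; first by rewrite d1.
rewrite derive1nS derive1E d1.
by have ? := is_derive_jet1 0 x; apply: derive_val.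
Qed.

(** * Derivatives on the closed half-line *)

Lemma has_derivative_onP {R : realType} (f f' : R -> R) (t e : R) :
  has_derivative_on `[0, +oo[ f f' -> 0 <= t -> 0 < e ->
  exists2 d, 0 < d & forall s, 0 <= s -> s != t -> `|t - s| < d ->
    `|f' t - (f s - f t) / (s - t)| < e.
Proof.
move=> hf t0 e0; have := hf t; rewrite /= in_itv/= andbT => /(_ t0).
move=> /cvgrPdist_lt/(_ _ e0)/nbhs_ballP[d d0 hd].
by exists d => // s s0 st sd; apply: hd; rewrite //= in_itv/= s0.
Qed.

Lemma has_derivative_on_is_derive {R : realType} (f f' : R -> R) (t : R) :
  has_derivative_on `[0, +oo[ f f' -> 0 < t -> is_derive t 1 f (f' t).
Proof.
move=> hf t0.
have hd : h^-1 *: (f (h *: 1 + t) - f t) @[h --> 0^'] --> f' t.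
  apply/cvgrPdist_lt => e e0.
  have [d d0 hd] := has_derivative_onP _ _ _ _ hf (ltW t0) e0.
  apply/nbhs_ballP; exists (Num.min d t); first by rewrite /= lt_min d0.
  move=> h; rewrite /ball/= /ball_/= sub0r normrN lt_min => /andP[h1 h2] h0.
  have -> : h *: 1 = h :> R by rewrite /GRing.scale/= mulr1.
  have := hd (h + t); rewrite addrK mulrC; apply.
  - by have := ler_norm (- h); rewrite normrN; lra.
  - by rewrite -subr_eq0 addrK.
  - by rewrite opprD addrCA subrr addr0 normrN.
by split; [apply/cvg_ex; exists (f' t)|exact: cvg_lim hd].
Qed.

(** Freezing the function at its initial value for negative arguments turns
    one-sided regularity at [0] into continuity on the whole line. *)
Lemma has_derivative_on_continuous {R : realType} (f f' : R -> R) :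
  has_derivative_on `[0, +oo[ f f' -> continuous (fun s : R => f (Num.max 0 s)).
Proof.
move=> hf t; set m := Num.max 0 t.
have m0 : 0 <= m by rewrite le_max lexx.
have [d d0 hd] := has_derivative_onP _ _ _ _ hf m0 ltr01.
have K0 : 0 < `|f' m| + 1 by rewrite ltr_wpDl.
apply/cvgrPdist_lt => e e0; apply/nbhs_ballP.
exists (Num.min d (e / (`|f' m| + 1))).
  by rewrite /= lt_min d0 divr_gt0.
move=> s; rewrite /ball_/= lt_min ltr_pdivlMr// => /andP[sd se].
set n := Num.max 0 s.
have n0 : 0 <= n by rewrite le_max lexx.
have mn : `|m - n| <= `|t - s|.
  have := ler_norm (t - s); have := ler_norm (- (t - s)).
  by rewrite normrN /m /n ler_norml; case: (leP 0 t); case: (leP 0 s); lra.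
have [->|nm] := eqVneq n m; first by rewrite subrr normr0.
have := hd n n0 nm (le_lt_trans mn sd); rewrite distrC => q1.
have qK : `|(f n - f m) / (n - m)| <= `|f' m| + 1.
  rewrite -[X in `|X|](subrK (f' m)) addrC (le_trans (ler_normD _ _))//.
  by rewrite lerD// ltW.
apply: le_lt_trans se.
rewrite distrC -[f n - f m](@divfK _ (n - m)) ?subr_eq0//.
by rewrite normrM mulrC ler_pM// distrC.
Qed.

(** * The jet along a Rayleigh solution *)

Lemma continuous_bounded_itv {R : realType} (g : R -> R) (T : R) :
  0 <= T -> continuous g ->
  exists M : R, forall s : R, 0 <= s <= T -> `|g s| <= M.
Proof.
move=> T0 cg.
have [|c _ hc] := @EVT_max R (fun s => `|g s|) 0 T T0.
  by apply: continuous_subspaceT => s; apply: cvg_norm; exact: cg.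
by exists `|g c| => s sT; apply: hc; rewrite in_itv.
Qed.

(** With [w = v(t, f(t))] and [z = w'], the Rayleigh equation is exactly what
    makes [z' = A w + B z] with [A = 1/4 + f f'] and [B = t / 2 + 2 f'^2]:
    the terms of [z'] other than [v (1/4 + f f')] are
    [(t / 4 + f'^2) (v_xx + 2 f' v_x)], and the last factor is [2 z]. Then
    [w^2 + z^2] satisfies a Gronwall inequality. *)
Lemma jet0_along_rayleigh {R : realType} (f f' f'' : R -> R)
  (hf' : has_derivative_on `[0, +oo[ f f')
  (hf'' : has_derivative_on `[0, +oo[ f' f'')
  (hode : forall t : R, 0 <= t ->
    f'' t = 2 * f' t ^+ 3 - 2^-1 * t * f' t - 4^-1 * f t)
  (h0 : jet0 0 (f 0) = 0)
  (h1 : jet2 0 (f 0) / 2 + f' 0 * jet1 0 (f 0) = 0) (T : R) :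
  0 <= T -> jet0 T (f T) = 0.
Proof.
move=> T0.
pose F (s : R) := f (Num.max 0 s); pose P (s : R) := f' (Num.max 0 s).
have maxE (s : R) : 0 <= s -> Num.max 0 s = s by move=> /max_r.
have cF : continuous F by exact: has_derivative_on_continuous hf'.
have cP : continuous P by exact: has_derivative_on_continuous hf''.
have dmax (g g' : R -> R) (s : R) : has_derivative_on `[0, +oo[ g g' -> 0 < s ->
    is_derive s 1 (fun r => g (Num.max 0 r)) (g' s).
  move=> hg s0; have ? := has_derivative_on_is_derive _ _ _ hg s0.
  apply: (near_eq_is_derive (f := g)).
  by near=> r; rewrite maxE// ltW//; near: r; exact: lt_nbhsr.
have dF (s : R) : 0 < s -> is_derive s 1 F (P s).
  by move=> s0; rewrite /P maxE ?ltW//; exact: dmax hf' s0.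
have dP (s : R) : 0 < s -> is_derive s 1 P (f'' s) by exact: dmax hf''.
have [MF hMF] := continuous_bounded_itv F T T0 cF.
have [MP hMP] := continuous_bounded_itv P T T0 cP.
pose w s := jet0 s (F s).
pose z s := jet2 s (F s) / 2 + P s * jet1 s (F s).
pose A s := 4^-1 + F s * P s.
pose B s := s / 2 + 2 * P s ^+ 2.
have MP0 : 0 <= MP.
  by apply: le_trans (hMP 0 _); rewrite ?normr_ge0// lexx.
have bdP (r : R) : 0 < r < T -> `|r| <= T + MP /\ `|P r| <= T + MP.
  move=> /andP[r0 rT].
  have := hMP r; rewrite (ltW r0) (ltW rT) => /(_ isT).
  by rewrite (gtr0_norm r0); split; lra.
have dwz (s : R) : 0 < s < T -> is_derive s 1 w (z s) /\
    is_derive s 1 z (A s * w s + B s * z s).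
  move=> sT; have /andP[s0 _] := sT.
  have [d0 d1 d2] := is_derive_jet_curve F P 0 T (T + MP) s
    (fun r rT => dF r (proj1 (andP rT))) bdP sT.
  split; first exact: d0.
  have dPs := dP s s0.
  have zE : z = 2^-1 \*: (fun r => jet2 r (F r)) + P * (fun r => jet1 r (F r)).
    by apply/funext => r; rewrite /z !fctE/= -![_ *: _]/(_ * _); ring.
  rewrite {1}zE.
  apply: (is_derive_eq (is_deriveD (is_deriveZ _ d2) (is_deriveM dPs d1))).
  rewrite hode ?ltW// -/(F s) /A /B /w /z /GRing.scale/=.
  by rewrite /P /F maxE ?ltW//; field.
pose N := w ^+ 2 + z ^+ 2.
pose dN s := 2 * w s * z s + 2 * z s * (A s * w s + B s * z s).
(* [(1 + sup |A|) + 2 sup B], since [2 (1 + A) w z <= |1 + A| (w^2 + z^2)]. *)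
pose K := 1 + (4^-1 + MF * MP) + 2 * (T / 2 + 2 * MP ^+ 2).
have cN : continuous N.
  have cmc k : continuous (fun s : R => moment cos k s (F s)).
    apply: continuous_moment_curve => //; first exact: continuous_cos.
    exact: normr_cos_le1.
  have cms k : continuous (fun s : R => moment sin k s (F s)).
    apply: continuous_moment_curve => //; first exact: continuous_sin.
    exact: normr_sin_le1.
  have cw : continuous w by exact: cmc.
  have cz : continuous z.
    move=> s; apply: cvgD; apply: cvgM.
    - by apply: cvgN; exact: cmc.
    - exact: cvg_cst.
    - exact: cP.
    - by apply: cvgN; exact: cms.
  move=> s; rewrite /N !expr2.
  by apply: cvgD; apply: cvgM; (exact: cw || exact: cz).
have : N T <= 0.
  have dNs (s : R) : 0 < s < T -> is_derive s 1 N (dN s).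
    move=> /dwz[dw dz].
    have sq (g : R -> R) dg : is_derive s 1 g dg ->
        is_derive s 1 (g ^+ 2) (2 * g s * dg).
      by move=> ?; apply: is_derive_eq.
    exact: is_deriveD (sq _ _ dw) (sq _ _ dz).
  apply: (gronwall_le0 N dN K 0 T T0 _ dNs).
  - exact: continuous_subspaceT.
  - move=> s sT; rewrite /N /dN !fctE.
    have /andP[s0 sT'] := sT.
    have sT0 : 0 <= s <= T by rewrite !ltW.
    have hA : `|1 + A s| <= 1 + (4^-1 + MF * MP).
      rewrite (le_trans (ler_normD _ _))// normr1 lerD2l.
      rewrite (le_trans (ler_normD _ _))// ger0_norm// lerD2l normrM.
      by rewrite ler_pM//; [exact: hMF|exact: hMP].
    have hB : B s <= T / 2 + 2 * MP ^+ 2.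
      rewrite /B lerD//; first by lra.
      by rewrite ler_pM2l// -real_normK ?num_real// lerXn2r ?nnegrE// hMP.
    have w0 := sqr_ge0 (w s); have z0 := sqr_ge0 (z s).
    have := ler_wpM2r z0 hB.
    have : 0 <= (T / 2 + 2 * MP ^+ 2) * w s ^+ 2.
      by rewrite mulr_ge0// addr_ge0 ?divr_ge0// mulr_ge0// sqr_ge0.
    have := ler_wpM2r (addr_ge0 w0 z0) hA.
    have : 2 * ((1 + A s) * (w s * z s)) <= `|1 + A s| * (w s ^+ 2 + z s ^+ 2).
      have := sqr_ge0 (w s - z s); have := sqr_ge0 (w s + z s).
      by case: (ger0P (1 + A s)) => c0; nra.
    rewrite /K; lra.
  - rewrite /N !fctE /w /z /F /P maxE//.
    by rewrite h0 h1 !expr0n/= addr0.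
rewrite /N !fctE => NT.
have wT : w T = jet0 T (f T) by rewrite /w /F maxE.
apply/eqP; rewrite -wT -sqrf_eq0; apply/eqP.
by have := sqr_ge0 (w T); have := sqr_ge0 (z T); lra.
Unshelve. all: by end_near.
Qed.

Theorem theorem4p2 (R : realType) (xi : R) (f f' f'' : R -> R)
  (hxi : airy4 xi = 0)
  (hf' : has_derivative_on `[0, +oo[ f f')
  (hf'' : has_derivative_on `[0, +oo[ f' f'')
  (hode : forall t : R, 0 <= t ->
    f'' t = 2 * f' t ^+ 3 - 2^-1 * t * f' t - 4^-1 * f t)
  (hf0 : f 0 = xi)
  (hf'0 : f' 0 = - (((@airy4 R)^`(2))%classic xi / (2 * ((@airy4 R)^`(1))%classic xi))) :
  forall t : R, 0 <= t -> pearcey t (f t) = 0.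
Proof.
move=> t t0.
have c0 : (2 * pi)^-1 != 0 :> R by rewrite invr_eq0 mulf_neq0// gt_eqF// pi_gt0.
have p0 : jet0 0 xi = 0.
  by move: hxi; rewrite airy4E => /eqP; rewrite mulf_eq0 (negPf c0) => /eqP.
have p1 := jet0_zero_simple 0 xi (lexx 0) p0.
rewrite pearceyE (jet0_along_rayleigh f f' f'' hf' hf'' hode) ?mulr0 ?hf0//.
rewrite hf'0; have [-> ->] := derive_airy4 xi.
move: ((2 * pi)^-1) c0 (jet1 0 xi) p1 (jet2 0 xi) => c c0 q q0 r.
by field; rewrite q0 c0.
Qed.
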